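(* Let $N>1$, let $\boldsymbol z=(z_1,\dots,z_N)$ be pairwise distinct complex numbers, and let every site carry the defining representation of $\mathfrak{gl}(m|n)$, i.e. $\lambda^{(i)}=\epsilon_1$, $L(\lambda^{(i)})=\mathbb C^{m|n}$ and $v_{\lambda^{(i)}}=e_1$ for $1\le i\le N$. Let $\boldsymbol l=(l_1,\dots,l_{m+n-1})$ be non-negative integers with sum $l$ and $c:\{1,\dots,l\}\to\{1,\dots,m+n-1\}$ a function with $|c^{-1}(p)|=l_p$ for all $p$. If $\boldsymbol t=(t_1,\dots,t_l)\in\mathbb C^l$ satisfies the Bethe equations $$-\sum_{s=1}^N\frac{(\alpha_{c(i)},\epsilon_1)}{t_i-z_s}+\sum_{j\ne i}\frac{(\alpha_{c(i)},\alpha_{c(j)})}{t_i-t_j}=0,\qquad i=1,\dots,l,$$ then $w(\boldsymbol z,\boldsymbol t)\in(\mathbb C^{m|n})^{\otimes N}$ is an eigenvector of the Gaudin Hamiltonian $$\mathcal H_i=\sum_{j\neq i}\frac{\sum_{a,b}E^{(i)}_{ab}E^{(j)}_{ba}(-1)^{|b|}}{z_i-z_j}$$ with eigenvalue $$\mathcal E_i=\sum_{\substack{j=1\\ j\ne i}}^N\frac1{z_i-z_j}+\sum_{\substack{j=1\\ c(j)=1}}^{l}\frac1{t_j-z_i},$$ for each $1\le i\le N$.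
   Context: Lie superalgebra. $\mathbb C^{m|n}$ is the complex superspace with homogeneous basis $e_1,\dots,e_{m+n}$, $m$ of which are even and $n$ odd, in any fixed order subject to $e_1$ being even; $|a|\in\{0,1\}$ is the parity of $e_a$. $\mathfrak{gl}(m|n)$ has basis $E_{ab}$ ($1\le a,b\le m+n$) of parity $|a|+|b|$, with $[E_{ab},E_{cd}]=\delta_{bc}E_{ad}-(-1)^{(|a|+|b|)(|c|+|d|)}\delta_{ad}E_{cb}$; it acts on its defining representation $\mathbb C^{m|n}$ by $E_{ab}e_c=\delta_{bc}e_a$. $\mathfrak h$ is spanned by the $E_{aa}$; $\epsilon_a\in\mathfrak h^*$ is the basis dual to $E_{aa}$, with bilinear form $(\epsilon_a,\epsilon_b)=(-1)^{|a|}\delta_{ab}$; simple roots $\alpha_a=\epsilon_a-\epsilon_{a+1}$; $F_a=E_{a+1,a}$ with parity $|F_a|$ equal to $|a|+|a+1|$ mod 2, $1\le a\le m+n-1$. Tensor products follow the super sign rule $(a\otimes b)(v\otimes w)=(-1)^{|b||v|}av\otimes bw$; $E^{(k)}_{ab}$ denotes $1\otimes\cdots\otimes E_{ab}\otimes\cdots\otimes1$ with $E_{ab}$ in the $k$-th tensor factor. Weight function. Let $P_{l,N}$ be the set of ordered partitions: tuples $\boldsymbol n=(n^1_1,\dots,n^1_{p_1};\dots;n^N_1,\dots,n^N_{p_N})$ with $p_k\ge0$, $p_1+\dots+p_N=l$, whose concatenation is a permutation of $(1,\dots,l)$. Put $$F_{\boldsymbol n}v=F_{c(n^1_1)}\cdots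 F_{c(n^1_{p_1})}e_1\otimes\cdots\otimes F_{c(n^N_1)}\cdots F_{c(n^N_{p_N})}e_1,$$ $$\omega_{\boldsymbol n}(\boldsymbol z,\boldsymbol t)=\prod_{k=1}^N\frac1{(t_{n^k_1}-t_{n^k_2})\cdots(t_{n^k_{p_k-1}}-t_{n^k_{p_k}})(t_{n^k_{p_k}}-z_k)}$$ (the $k$-th factor is $1$ if $p_k=0$), and let $(-1)^{|\boldsymbol n|}$ be $-1$ to the number of pairs $i<j$ with $|F_{c(i)}|=|F_{c(j)}|=1$ such that $j$ appears before $i$ in the concatenated list. The weight function is $w(\boldsymbol z,\boldsymbol t)=\sum_{\boldsymbol n\in P_{l,N}}(-1)^{|\boldsymbol n|}\omega_{\boldsymbol n}(\boldsymbol z,\boldsymbol t)F_{\boldsymbol n}v$. Conventions. In the Bethe equations, terms with zero coefficient are omitted and a solution is required to have nonzero denominators in all terms with nonzero coefficient. The value of $w$ at a solution is the value of the rational function there (possible apparent poles, after summation, cancel). ''$w$ is an eigenvector of $\mathcal H_i$ with eigenvalue $\mathcal E_i$'' means $\mathcal H_iw=\mathcal E_iw$; $w\ne0$ is not asserted. *)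

(* Defs.v *)
From HB Require Import structures.
From mathcomp Require Import all_boot all_order all_algebra.
From mathcomp Require Import reals complex mpoly.

Set Implicit Arguments.
Unset Strict Implicit.
Unset Printing Implicit Defensive.

Import GRing.Theory.
Local Open Scope ring_scope.

(* Indices are 0-based: with r = m + n - 1, the basis e_1, ..., e_{m+n} of
   C^{m|n} is indexed by 'I_r.+1 and the simple roots by 'I_r.  The parity
   function [par] is true on the odd basis vectors.  The algebra below is
   written over an arbitrary field K, because the weight function is needed
   over a field of rational functions and the Hamiltonians over C. *)

Definition node_lo (r : nat) (a : 'I_r) : 'I_r.+1 := widen_ord (leqnSn r) a.
Definition node_hi (r : nat) (a : 'I_r) : 'I_r.+1 := lift ord0 a.

Section DefiningRepresentation.
Variables (K : fieldType) (r : nat) (par : 'I_r.+1 -> bool).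

Definition evec (a : 'I_r.+1) : 'cV[K]_r.+1 := delta_mx a 0.

Definition Emx (a b : 'I_r.+1) : 'M[K]_r.+1 := delta_mx a b.

Definition Fmx (a : 'I_r) : 'M[K]_r.+1 := Emx (node_hi a) (node_lo a).

Definition parE (a b : 'I_r.+1) : bool := par a (+) par b.
Definition parF (a : 'I_r) : bool := parE (node_hi a) (node_lo a).

(* h^* in the basis epsilon_1, ..., epsilon_{m+n} *)
Definition eps (a : 'I_r.+1) : 'rV[K]_r.+1 := delta_mx 0 a.
Definition alpha (a : 'I_r) : 'rV[K]_r.+1 := eps (node_lo a) - eps (node_hi a).
Definition bform (u v : 'rV[K]_r.+1) : K :=
  \sum_a (-1) ^+ par a * u 0 a * v 0 a.

End DefiningRepresentation.

Section TensorPower.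
Variables (K : fieldType) (r N : nat) (par : 'I_r.+1 -> bool).

(* (C^{m|n})^{\otimes N}, in coordinates with respect to the basis
   e_{x_1} \otimes ... \otimes e_{x_N}, x : {ffun 'I_N -> 'I_r.+1} *)
Definition tensor := {ffun {ffun 'I_N -> 'I_r.+1} -> K^o}.

Definition ptensor (v : 'I_N -> 'cV[K]_r.+1) : tensor :=
  [ffun x : {ffun 'I_N -> 'I_r.+1} => \prod_k v k (x k) 0].

(* E_{ab}^{(k)}, extended linearly from the basis: moving E_{ab} past the
   first k - 1 tensor factors produces the sign of the super sign rule. *)
Definition Esite (k : 'I_N) (a b : 'I_r.+1) (w : tensor) : tensor :=
  \sum_(y : {ffun 'I_N -> 'I_r.+1})
    w y *: ((-1 : K) ^+ (\sum_(s < N | (s < k)%N) parE par a b * par (y s)) *: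
      ptensor (fun s => if s == k then Emx K a b *m evec K (y s)
                        else evec K (y s))).

Definition gaudin (z : 'I_N -> K) (i : 'I_N) (w : tensor) : tensor :=
  \sum_(j | j != i) (z i - z j)^-1 *:
    \sum_a \sum_b (-1 : K) ^+ par b *: Esite i a b (Esite j b a w).

End TensorPower.

Section WeightFunction.
Variables (K : fieldType) (r N l : nat) (par : 'I_r.+1 -> bool).
Variable (c : 'I_l -> 'I_r).

(* A part of an ordered partition of (1, ..., l) has at most l entries, so
   bounded sequences lose nothing and make the index set of w finite. *)
Definition parts := {ffun 'I_N -> l.-bseq 'I_l}.

Definition concat (n : parts) : seq 'I_l :=
  flatten [seq (n k : seq 'I_l) | k <- enum 'I_N].

Definition ordered_partition : {set parts} :=
  [set n : parts | perm_eq (concat n) (enum 'I_l)].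

Definition Fn_factor (s : seq 'I_l) : 'cV[K]_r.+1 :=
  foldr (fun i v => Fmx K (c i) *m v) (evec K ord0) s.

Definition Fnv (n : parts) : tensor K r N := ptensor (fun k => Fn_factor (n k)).

(* (t_{s_1} - t_{s_2}) ... (t_{s_{p-1}} - t_{s_p}) (t_{s_p} - zk) *)
Fixpoint chain_den (t : 'I_l -> K) (zk : K) (s : seq 'I_l) : K :=
  if s is i :: s' then (t i - head zk (map t s')) * chain_den t zk s' else 1.

Definition omega (z : 'I_N -> K) (t : 'I_l -> K) (n : parts) : K :=
  \prod_k (chain_den t (z k) (n k))^-1.

Definition odd_inversions (n : parts) : {set 'I_l * 'I_l} :=
  [set ij : 'I_l * 'I_l | [&& (ij.1 < ij.2)%N, parF par (c ij.1), parF par (c ij.2)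
              & (index ij.2 (concat n) < index ij.1 (concat n))%N]].

Definition weight_fun (z : 'I_N -> K) (t : 'I_l -> K) : tensor K r N :=
  \sum_(n in ordered_partition)
    ((-1) ^+ #|odd_inversions n| * omega z t n) *: Fnv n.

End WeightFunction.

Definition bethe_equations (K : fieldType) (r N l : nat) (par : 'I_r.+1 -> bool)
    (c : 'I_l -> 'I_r) (z : 'I_N -> K) (t : 'I_l -> K) : Prop :=
  let A1 i := bform par (alpha K (c i)) (eps K ord0) in
  let AA i j := bform par (alpha K (c i)) (alpha K (c j)) in
  forall i : 'I_l,
  [/\ forall s : 'I_N, A1 i != 0 -> t i != z s,
      forall j : 'I_l, j != i -> AA i j != 0 -> t i != t j
    & - (\sum_(s < N | A1 i != 0) A1 i / (t i - z s))
      + \sum_(j < l | (j != i) && (AA i j != 0)) AA i j / (t i - t j) = 0].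

Definition gaudin_eigenvalue (K : fieldType) (r N l : nat)
    (c : 'I_l -> 'I_r) (z : 'I_N -> K) (t : 'I_l -> K) (i : 'I_N) : K :=
  \sum_(j < N | j != i) (z i - z j)^-1
  + \sum_(j < l | val (c j) == 0%N) (t j - z i)^-1.

Notation ratfun K d := {fraction {mpoly K[d]}}.

(* The rational function f in d variables is regular at x, with value v there. *)
Definition rat_value (K : fieldType) (d : nat) (f : ratfun K d)
    (x : 'I_d -> K) (v : K) : Prop :=
  exists p q : {mpoly K[d]},
    [/\ q.@[x] != 0, f = tofrac p / tofrac q & v = p.@[x] / q.@[x]].

Lemma rat_value_uniq (K : fieldType) (d : nat) (f : ratfun K d)
    (x : 'I_d -> K) (v v' : K) :
  rat_value f x v -> rat_value f x v' -> v = v'.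
Proof.
have cross (F : fieldType) (a b a' b' : F) :
    b != 0 -> b' != 0 -> a / b = a' / b' -> a * b' = a' * b.
  by move=> b0 b0' /eqP; rewrite eqr_div // => /eqP.
have nz (q : {mpoly K[d]}) : q.@[x] != 0 -> tofrac q != 0.
  by rewrite tofrac_eq0; apply: contraNneq => ->; rewrite meval0.
move=> [p [q [qx -> ->]]] [p' [q' [qx' e ->]]].
have /eqP := cross _ _ _ _ _ (nz _ qx) (nz _ qx') e.
rewrite -!rmorphM tofrac_eq => /eqP {}e.
by apply/eqP; rewrite eqr_div // -!mevalM e.
Qed.

(* w as a vector of rational functions in the N + l variables (z, t) *)
Definition weight_rat (K : fieldType) (r N l : nat) (par : 'I_r.+1 -> bool)
    (c : 'I_l -> 'I_r) : tensor (ratfun K (N + l)) r N :=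
  weight_fun par c (fun k : 'I_N => tofrac 'X_(lshift l k))
                   (fun i : 'I_l => tofrac 'X_(rshift N i)).

Definition joint_point (K : fieldType) (N l : nat) (z : 'I_N -> K)
    (t : 'I_l -> K) (i : 'I_(N + l)) : K :=
  match split i with inl k => z k | inr j => t j end.

Definition weight_value (K : fieldType) (r N l : nat) (par : 'I_r.+1 -> bool)
    (c : 'I_l -> 'I_r) (z : 'I_N -> K) (t : 'I_l -> K)
    (W : tensor K r N) : Prop :=
  forall x, rat_value (weight_rat K N par c x) (joint_point z t) (W x).

(* Main.v *)
Require Import Defs.
From mathcomp Require Import all_boot all_order all_algebra.
From mathcomp Require Import perm ring zify.
From mathcomp Require Import reals complex mpoly.

Set Implicit Arguments.
Unset Strict Implicit.
Unset Printing Implicit Defensive.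

Import GRing.Theory.
Local Open Scope ring_scope.

(* In C^{m|n} a word F_{c(n_1)} ... F_{c(n_p)} e_1 is nonzero only if its colors are
   p, ..., 1, so the coordinate of w at e_{x_1} (x) ... (x) e_{x_N} is a signed sum, over
   the ways to place the variables, of a product of chains starting at the z_k.  The
   (i, j) summand of H_i is the super flip of the sites i and j, whose sign is absorbed by
   the sign of the placement; hence it acts on w by exchanging z_i and z_j.  The
   difference H_i w - E_i w is then pushed up the chain at site i: the Bethe equation of
   the first variable of that chain turns it, up to sign, into the same expression with
   that variable in the role of z_i and the variables of color 1 in the role of z, and at
   the top of the chain the expression vanishes term by term.  The argument divides by
   differences of variables of equal color; if one of these is zero, the color is odd
   and w = 0 by antisymmetry. *)

(** * Telescoping identity for products over chains *)

Section ChainIdentity.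
Variables (K : fieldType) (T I : finType) (P : pred T).
Variables (x : I -> nat) (v : T -> I -> nat -> K) (s : T -> K) (chi : nat -> K).

(* [u k 0] stands for z_k and [u k j.+1] for the variable of color j (0-based) at
   site k, where [x k] variables sit. *)
Definition chains (u : I -> nat -> K) : K :=
  \prod_k \prod_(j < x k) (u k j.+1 - u k j)^-1.

Definition swap_level (i k : I) (m : nat) (u : I -> nat -> K) p j :=
  if j == m then u (tperm i k p) j else u p j.

(** New over old value of the links from level [m] to level [m.+1] when the level [m] entries of [i]
    and [k] are exchanged. A chain ending at level [m] has no such link and contributes 1. *)
Definition swap_ratio (i k : I) (m : nat) (u : I -> nat -> K) : K :=
  (if (m < x i)%N then (u i m.+1 - u i m) / (u i m.+1 - u k m) else 1)
  * (if (m < x k)%N then (u k m.+1 - u k m) / (u k m.+1 - u i m) else 1).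

(** Here [T] models the placements of the variables, [s] their signs, and [psi] exchanges the
    variables at level [m.+1] of [i] and [k]; [chi m] is the sign this costs, -1 for an odd
    color. *)
Hypothesis swapP : forall i k m, i != k -> (m < x i)%N -> (m < x k)%N ->
  exists2 psi : T -> T,
    forall n, P n -> P (psi n) /\ psi (psi n) = n
    & forall n, P n -> s (psi n) = chi m * s n
               /\ forall p j, v (psi n) p j = swap_level i k m.+1 (v n) p j.

Hypothesis neq_next : forall n i k m, P n -> (m < x i)%N -> (m <= x k)%N ->
  v n i m.+1 - v n k m != 0.
Hypothesis neq_same : forall n i k m, P n -> i != k -> (m <= x i)%N ->
  (m <= x k)%N -> v n i m - v n k m != 0.

(** The Bethe equation of the variable at level [m.+1] of site [i], scaled so that the sum over the
    level below has coefficient 1. For [m = 0] that level consists of the z_k. *)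
Hypothesis betheP : forall n i m, P n -> (m < x i)%N ->
  \sum_(k | (m <= x k)%N) (v n i m.+1 - v n k m)^-1 =
  (1 + chi m) * (\sum_(k | (k != i) && (m < x k)%N) (v n i m.+1 - v n k m.+1)^-1)
  - chi m * (\sum_(k | (m.+1 < x k)%N) (v n i m.+1 - v n k m.+2)^-1).

Lemma chains_swap0 (u : I -> nat -> K) i k : i != k ->
    (forall p q m, (m < x p)%N -> (m <= x q)%N -> u p m.+1 - u q m != 0) ->
  chains (swap_level i k 0 u) = chains u * swap_ratio i k 0 u.
Proof.
move=> ik nz.
rewrite /chains (bigD1 i) //= [in RHS](bigD1 i) //=.
rewrite (bigD1 k) 1?eq_sym //= [in RHS](bigD1 k) 1?eq_sym //=.
rewrite -!mulrA; rewrite (eq_bigr (fun p => \prod_(j < x p) (u p j.+1 - u p j)^-1));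
  last first.
  move=> p /andP[pi pk]; apply: eq_bigr => j _.
  by rewrite /swap_level tpermD // 1?eq_sym //; case: ifP.
have one p q : tperm i k p = q ->
    \prod_(j < x p) (swap_level i k 0 u p j.+1 - swap_level i k 0 u p j)^-1
    = \prod_(j < x p) (u p j.+1 - u p j)^-1
      * (if (0 < x p)%N then (u p 1%N - u p 0%N) / (u p 1%N - u q 0%N) else 1).
  move=> e; have := @nz p p 0; have := @nz p q 0; case: (x p) => [|m] n1 n2.
    by rewrite !big_ord0 mulr1.
  rewrite !big_ord_recl /= {2}/swap_level eqxx e /swap_level /=.
  rewrite -!mulrA; set A := (\prod_(_ < m) _); field; rewrite n1 // n2 //.
rewrite (one i k) ?tpermL // (one k i) ?tpermR // /swap_ratio.
ring.
Qed.

(** Unlike level 0, a positive level also has links below it; these give the last factor. *)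
Lemma chains_swapS (u : I -> nat -> K) i k m : i != k ->
    (m < x i)%N -> (m < x k)%N ->
    (forall p q m, (m < x p)%N -> (m <= x q)%N -> u p m.+1 - u q m != 0) ->
  chains (swap_level i k m.+1 u) = chains u * swap_ratio i k m.+1 u
    * ((u i m.+1 - u i m) * (u k m.+1 - u k m)
       / ((u i m.+1 - u k m) * (u k m.+1 - u i m))).
Proof.
move=> ik mi mk nz.
rewrite /chains (bigD1 i) //= [in RHS](bigD1 i) //=.
rewrite (bigD1 k) 1?eq_sym //= [in RHS](bigD1 k) 1?eq_sym //=.
rewrite -!mulrA; rewrite (eq_bigr (fun p => \prod_(j < x p) (u p j.+1 - u p j)^-1));
  last first.
  move=> p /andP[pi pk]; apply: eq_bigr => j _.
  by rewrite /swap_level tpermD // 1?eq_sym //; do 2!case: ifP.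
have one p q : tperm i k p = q -> (m < x p)%N -> (m < x q)%N ->
    \prod_(j < x p) (swap_level i k m.+1 u p j.+1 - swap_level i k m.+1 u p j)^-1
    = \prod_(j < x p) (u p j.+1 - u p j)^-1
      * (if (m.+1 < x p)%N then (u p m.+2 - u p m.+1) / (u p m.+2 - u q m.+1) else 1)
      * ((u p m.+1 - u p m) / (u q m.+1 - u p m)).
  move=> e mp mq; have n0 := nz p p m mp (ltnW mp).
  have n1 := nz q p m mq (ltnW mp).
  rewrite (bigD1 (Ordinal mp)) //= [in RHS](bigD1 (Ordinal mp)) //=.
  rewrite {1 2}/swap_level eqxx e (ltn_eqF (ltnSn m)).
  case: ifPn => mp'.
    have n2 := nz p p _ mp' mp; have n3 := nz p q _ mp' mq.
    have d : Ordinal mp' != Ordinal mp by rewrite -val_eqE /= gtn_eqF.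
    rewrite (bigD1 (Ordinal mp')) //= [in RHS](bigD1 (Ordinal mp')) //=.
    rewrite {1 2}/swap_level eqxx (gtn_eqF (ltnSn m.+1)) e.
    rewrite (eq_bigr (fun j : 'I_(x p) => (u p j.+1 - u p j)^-1)); last first.
      move=> j /andP[]; rewrite -!val_eqE /= => j1 j2.
      by rewrite /swap_level eqSS (negbTE j1) (negbTE j2).
    by set A := \prod_(_ < _ | _) _; field; rewrite n0 n1 n2 n3.
  rewrite (eq_bigr (fun j : 'I_(x p) => (u p j.+1 - u p j)^-1)); last first.
    move=> j; rewrite -!val_eqE /= => j1.
    rewrite /swap_level eqSS (negbTE j1) (_ : (j == m.+1 :> nat) = false) //.
    by apply: contraNF mp' => /eqP <-.
  by set A := \prod_(_ < _ | _) _; field; rewrite n0 n1.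
rewrite (one i k) ?tpermL // (one k i) ?tpermR // /swap_ratio.
rewrite !invfM; ring.
Qed.

(* [defect i 0 = 0] is the eigenvalue equation in coordinate x; [defect i m] is the
   same expression for the chains truncated below level m, with [v n i m] as z_i. *)
Definition defect (i : I) (m : nat) : K :=
  \sum_(n | P n) s n * chains (v n) *
    (\sum_(k | (k != i) && (m <= x k)%N)
        (swap_ratio i k m (v n) - 1) / (v n i m - v n k m)
     - \sum_(k | (m < x k)%N) (v n k m.+1 - v n i m)^-1).

(** Site [i] has no link above its top, so only the factor of [k] is left in [swap_ratio]. Its
    quotient equals the [k] term of the second sum if the chain at [k] is longer, and is 0
    otherwise. *)
Lemma defect_top i : defect i (x i) = 0.
Proof.
rewrite /defect big1 // => n Pn; rewrite [X in _ * X](_ : _ = 0) ?mulr0 //.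
apply/eqP; rewrite subr_eq0; apply/eqP.
rewrite [RHS](eq_bigl (fun k => ((k != i) && (x i <= x k)%N) && (x i < x k)%N)); last first.
  by move=> k; case: ltngtP => //=; case: (k =P i) => [->|]; rewrite ?ltnn ?andbF.
rewrite [RHS]big_mkcondr /=; apply: eq_bigr => k /andP[ki le_k].
rewrite /swap_ratio ltnn mul1r; case: ifP => lt_k; last by rewrite subrr mul0r.
have n1 := neq_next Pn lt_k (leqnn _).
have n2 := neq_same Pn ki le_k (leqnn _).
have n3 : v n i (x i) - v n k (x i) != 0 by rewrite -opprB oppr_eq0.
by field; rewrite n1 n3.
Qed.

(* The Bethe equation of the variable at level m.+1 of site i rewrites the bracket of
   [defect i m]; what then separates it from [defect i m.+1] cancels, for each k,
   against its image under the exchange of the level m.+1 variables of i and k. *)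
Lemma defect_step i m : (m < x i)%N ->
  defect i m = chi m * defect i m.+1.
Proof.
move=> mi.
(* Each factor of [swap_ratio] is 1 plus a fraction. [A n k] is the product of the two fractions
   over [v n i m - v n k m]; the remaining terms become single poles. *)
pose A n k := (v n k m - v n i m) / ((v n i m.+1 - v n k m) * (v n k m.+1 - v n i m)).
pose B n k := (v n i m.+1 - v n k m.+1)^-1.
have bracket n : P n ->
   \sum_(k | (k != i) && (m <= x k)%N)
        (swap_ratio i k m (v n) - 1) / (v n i m - v n k m)
     - \sum_(k | (m < x k)%N) (v n k m.+1 - v n i m)^-1
   = \sum_(k | (k != i) && (m < x k)%N) (A n k - (1 + chi m) * B n k)
     + chi m * \sum_(k | (m.+1 < x k)%N) (v n i m.+1 - v n k m.+2)^-1.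
  move=> Pn.
  have e : \sum_(k | (k != i) && (m < x k)%N) (A n k - (1 + chi m) * B n k)
     + chi m * \sum_(k | (m.+1 < x k)%N) (v n i m.+1 - v n k m.+2)^-1
    = \sum_(k | (k != i) && (m < x k)%N) A n k
      - \sum_(k | (m <= x k)%N) (v n i m.+1 - v n k m)^-1.
    rewrite betheP // big_split /= sumrN -mulr_sumr /B; ring.
  have D1 (Q : pred I) (F : I -> K) :
      Q i -> \sum_(k | Q k) F k = F i + \sum_(k | (k != i) && Q k) F k.
    by move=> Qi; rewrite (bigD1 i) //; congr (_ + _); apply: eq_bigl => k; rewrite andbC.
  have mk (F : I -> K) : \sum_(k | (k != i) && (m < x k)%N) F k
    = \sum_(k | (k != i) && (m <= x k)%N) if (m < x k)%N then F k else 0.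
    rewrite -big_mkcondr /=; apply: eq_bigl => k.
    by case: ltngtP => //=; rewrite ?andbT ?andbF.
  rewrite e (D1 (fun k => m < x k)%N) // (D1 (fun k => m <= x k)%N) ?(ltnW mi) //=.
  rewrite !mk !opprD ![_ + (- _ + _)]addrCA -!sumrN -!big_split /=; congr (_ + _).
  apply: eq_bigr => k /andP[ki mk'].
  have n1 := neq_next Pn mi mk'.
  have n2 : v n i m - v n k m != 0 by rewrite neq_same // 1?eq_sym // ltnW.
  have n3 := neq_next Pn mi (ltnW mi).
  rewrite /swap_ratio mi /A; case: ifP => lt_k; last by field; rewrite n1 n2.
  have n4 := neq_next Pn lt_k (ltnW mi).
  by field; rewrite n1 n2 n4.
apply/eqP; rewrite -subr_eq0 /defect mulr_sumr -sumrB.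
have cell k : (k != i) && (m < x k)%N ->
  \sum_(n | P n) s n * chains (v n) * (A n k - B n k - chi m * swap_ratio i k m.+1 (v n)
    * B n k) = 0.
  move=> /andP[ki mk]; rewrite eq_sym in ki.
  have [psi psiP psiE] := swapP ki mi mk.
  have nz n : P n -> forall p q m, (m < x p)%N -> (m <= x q)%N -> v n p m.+1 - v n q m != 0.
    by move=> Pn p q j; apply: neq_next.
  (* [X n] is [B n k] divided by the last factor of [chains_swapS]. After reindexing by [psi],
     [A - B] at [psi n] is exactly [X n], so the sum cancels term by term. *)
  pose X n := (v n i m.+1 - v n k m) * (v n k m.+1 - v n i m)
       / ((v n i m.+1 - v n i m) * (v n k m.+1 - v n k m)) * B n k.
  have e1 n : P n -> s n * chains (v n) * (chi m * swap_ratio i k m.+1 (v n) * B n k)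
     = s (psi n) * chains (v (psi n)) * X n.
    move=> Pn; have [-> vE] := psiE n Pn.
    have -> : chains (v (psi n)) = chains (swap_level i k m.+1 (v n)).
      by rewrite /chains; apply: eq_bigr => p _; apply: eq_bigr => j _; rewrite !vE.
    rewrite chains_swapS //; last exact: nz.
    rewrite /X.
    have n1 := nz n Pn i i m mi (ltnW mi). have n2 := nz n Pn i k m mi (ltnW mk).
    have n3 := nz n Pn k i m mk (ltnW mi). have n4 := nz n Pn k k m mk (ltnW mk).
    by set C := chains _; set D := swap_ratio _ _ _ _; set E := B n k; field;
      rewrite n1 n2 n3 n4.
  rewrite (eq_bigr (fun n => s n * chains (v n) * (A n k - B n k)
     - s (psi n) * chains (v (psi n)) * X n)); last first.
    by move=> n Pn; rewrite mulrBr e1.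
  rewrite sumrB [X in X - _](reindex_onto psi psi) /=; last by move=> n /psiP[].
  rewrite [X in X - _](eq_bigl P); last first.
    move=> n; apply/andP/idP => [[Pn /eqP e]|/psiP[-> ->]]; last by [].
    by rewrite -e; case: (psiP _ Pn).
  rewrite -sumrB big1 // => n Pn; rewrite -mulrBr.
  have [_ vE] := psiE n Pn.
  rewrite /A /X /B !vE /swap_level !eqxx tpermL tpermR !(ltn_eqF (ltnSn m)).
  have n1 := nz n Pn i i m mi (ltnW mi). have n2 := nz n Pn i k m mi (ltnW mk).
  have n3 := nz n Pn k i m mk (ltnW mi). have n4 := nz n Pn k k m mk (ltnW mk).
  have n5 := neq_same Pn ki mi mk.
  have n6 : v n k m.+1 - v n i m.+1 != 0 by rewrite -opprB oppr_eq0.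
  by rewrite [X in _ * X](_ : _ = 0) ?mulr0 //; field; rewrite ?n1 ?n2 ?n3 ?n4 ?n5 ?n6.
rewrite (eq_bigr (fun n => \sum_(k | (k != i) && (m < x k)%N)
   s n * chains (v n) * (A n k - B n k - chi m * swap_ratio i k m.+1 (v n) * B n k))).
  by rewrite exchange_big /= big1.
move=> n Pn; rewrite bracket // -mulr_sumr mulrCA -mulrBr; congr (_ * _).
have -> : \sum_(k | (m.+1 < x k)%N) (v n k m.+2 - v n i m.+1)^-1
    = - \sum_(k | (m.+1 < x k)%N) (v n i m.+1 - v n k m.+2)^-1.
  by rewrite -sumrN; apply: eq_bigr => k _; rewrite -invrN opprB.
rewrite opprK mulrDr opprD addrACA subrr addr0 mulr_sumr -sumrB.
apply: eq_bigr => k _.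
by rewrite /B; ring.
Qed.

Lemma defect_eq0 i m : (m <= x i)%N -> defect i m = 0.
Proof.
(* Induction on the distance [d] to the top of the chain at [i]. *)
move=> mi; move e: (x i - m)%N => d; elim: d m mi e => [|d IHd] m mi e.
  have -> : m = x i by apply/eqP; rewrite eqn_leq mi -subn_eq0 e.
  exact: defect_top.
have lt : (m < x i)%N by rewrite -subn_gt0 e.
by rewrite defect_step // IHd ?mulr0 // subnS e.
Qed.
End ChainIdentity.

(** * Sign of an ordered partition *)

Section Inversions.
Variables (l : nat) (p : pred 'I_l).

Definition cross_inversions (A B : seq 'I_l) : nat :=
  (\sum_(a <- A) \sum_(b <- B) [&& (b < a)%N, p a & p b])%N.

Fixpoint inversions (s : seq 'I_l) : nat :=
  if s is a :: s' then (cross_inversions [:: a] s' + inversions s')%N else 0%N.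

Lemma cross_inversions_catl A1 A2 B : cross_inversions (A1 ++ A2) B
  = (cross_inversions A1 B + cross_inversions A2 B)%N.
Proof. by rewrite /cross_inversions big_cat. Qed.

Lemma cross_inversions_catr A B1 B2 : cross_inversions A (B1 ++ B2)
  = (cross_inversions A B1 + cross_inversions A B2)%N.
Proof. by rewrite /cross_inversions -big_split; apply: eq_bigr => a _; rewrite big_cat. Qed.

Lemma inversions_cat A B : inversions (A ++ B)
  = (inversions A + inversions B + cross_inversions A B)%N.
Proof.
elim: A => [|a A IHA] /=; first by rewrite /cross_inversions big_nil addn0.
by rewrite IHA cross_inversions_catr -[in cross_inversions (a ::
  A) B](cat1s a A) cross_inversions_catl /=; lia.
Qed.

(** For disjoint lists, each pair of marked entries is an inversion in exactly one of the two
    orders. *)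
Lemma cross_inversions_sym A B : ~~ has (mem A) B ->
  (cross_inversions A B + cross_inversions B A = count p A * count p B)%N.
Proof.
move=> /hasPn AB; rewrite /cross_inversions [X in (_ + X)%N]exchange_big -big_split /=.
rewrite -!sum1_count !big_distrl /= [in RHS]big_mkcond /=.
rewrite [LHS]big_seq [RHS]big_seq; apply: eq_bigr => a aA.
rewrite -big_split /= mul1n [X in if _ then X else _]big_mkcond /=.
have -> : ((if p a then \sum_(b <- B) (if p b then 1 else 0) else 0)
    = \sum_(b <- B) (p a && p b))%N.
  by case: (p a) => //; rewrite ?big1 //; apply: eq_bigr => b _; case: (p b).
rewrite [LHS]big_seq [RHS]big_seq; apply: eq_bigr => b /AB bA.
have ab : (a : nat) != b by apply: contraNneq bA => /val_inj <-.
by case: ltngtP ab => //; case: (p a); case: (p b).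
Qed.

(** The move reverses exactly the pairs taken from two different blocks among [A], [M], [B]. Adding
    the old cross inversions twice, which is invisible mod 2, turns these into products of
    counts. *)
Lemma odd_inversions_block_swap A0 A M B B0 : uniq (A0 ++ A ++ M ++ B ++ B0) ->
  odd (inversions (A0 ++ B ++ M ++ A ++ B0)) =
  odd (inversions (A0 ++ A ++ M ++ B ++ B0)) (+) (odd (count p A) && odd (count p B))
    (+) ((odd (count p A) (+) odd (count p B)) && odd (count p M)).
Proof.
rewrite !cat_uniq !has_cat !negb_or.
move=> /and5P[_ _ _ /and3P[nAM nAB nAB0] /and5P[_ /andP[nMB _] _ _ _]].
have := cross_inversions_sym nAM; have := cross_inversions_sym nAB;
  have := cross_inversions_sym nMB.
move=> e1 e2 e3.
have : (inversions (A0 ++ B ++ M ++ A ++ B0) + (cross_inversions A M + cross_inversions A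
  B + cross_inversions M B).*2
  = inversions (A0 ++ A ++ M ++ B ++ B0) + count p A * count p B
    + (count p A + count p B) * count p M)%N.
  rewrite mulnDl [(count p B * _)%N]mulnC -e1 -e2 -e3 !inversions_cat
    !cross_inversions_catr.
  lia.
move/(congr1 odd); rewrite !oddD odd_double addbF => ->.
by rewrite !oddM oddD.
Qed.

(** A swap of blocks of length 1: since [p a = p b], the entries in between contribute evenly and
    only the pair itself counts. *)
Lemma odd_inversions_tperm a b s : uniq s -> a \in s -> b \in s -> a != b -> p a = p b ->
  odd (inversions (map (tperm a b) s)) = odd (inversions s) (+) p a.
Proof.
move=> us ains; case/splitPr: ains us => A0 B0 us; rewrite mem_cat in_cons eq_sym.
wlog: a b A0 B0 us / b \in B0.
  move=> wl /or3P[bA|/eqP->|bB] ab pab; first 1 last.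
  - by rewrite eqxx in ab.
  - by apply: wl => //; rewrite bB !orbT.
  case/splitPr: bA us ab => A1 A2 us ab.
  rewrite tpermC pab -catA /= in us *.
  apply: wl => //; first by rewrite mem_cat inE eqxx orbT.
    by rewrite mem_cat in_cons eqxx !orbT.
  by rewrite eq_sym.
move=> bB _ ab pab; case/splitPr: bB us => M B1 us.
have fix_ (s' : seq 'I_l) : a \notin s' -> b \notin s' -> map (tperm a b) s' = s'.
  move=> an bn; rewrite -[RHS]map_id; apply/eq_in_map => y ys /=.
  by rewrite tpermD //; [apply: contraNneq an|apply: contraNneq bn] => ->.
have := @odd_inversions_block_swap A0 [:: a] M [:: b] B1 us.
rewrite /= !addn0 pab addbb /= addbF andbb oddb => <-.
have : uniq (a :: b :: (A0 ++ M ++ B1)).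
  rewrite -(perm_uniq (s1 := A0 ++ a :: M ++ b :: B1)) //; apply/seq.permP => q.
  by rewrite /= !count_cat /= !count_cat /=; lia.
rewrite /= in_cons !mem_cat !negb_or.
move=> /and3P[/andP[_ /and3P[aA aM aB]] /and3P[bA bM bB] _].
by rewrite map_cat /= map_cat /= tpermL tpermR !fix_.
Qed.

Lemma card_inversions s : uniq s -> (forall i, i \in s) ->
  #|[set ij : 'I_l * 'I_l | [&& (ij.1 < ij.2)%N, p ij.1, p ij.2
              & (index ij.2 s < index ij.1 s)%N]]| = inversions s.
Proof.
move=> us alls; have e : perm_eq (index_enum 'I_l) s.
  by apply: uniq_perm => // [|i]; rewrite ?index_enum_uniq // mem_index_enum alls.
rewrite cardsE -sum1_card (eq_bigl (fun ij : 'I_l * 'I_l =>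
  [&& (ij.1 < ij.2)%N, p ij.1, p ij.2
              & (index ij.2 s < index ij.1 s)%N])) // big_mkcond /=.
rewrite -(pair_bigA _ (fun i j : 'I_l => if [&& (i < j)%N, p i, p j
              & (index j s < index i s)%N] then 1%N else 0%N)) /=.
rewrite (perm_big _ e) /=; under eq_bigr do rewrite (perm_big _ e) /=.
elim: s us {alls e} => [|a s IHs] /=; first by rewrite big_nil.
case/andP=> an us; rewrite big_cons big_cons ltnn /= add0n.
rewrite big1 ?add0n => [|j _]; last by rewrite eqxx ltn0 !andbF.
rewrite -IHs // /cross_inversions big_seq1 -big_split /= big_seq [RHS]big_seq.
apply: eq_bigr => i is_; rewrite big_cons eqxx.
have ai : (a == i) = false by apply: contraNF an => /eqP ->.
rewrite ai ltn0Sn andbT; congr (_ + _)%N.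
  by case: ltnP => // _; case: (p i); case: (p a).
rewrite big_seq [RHS]big_seq; apply: eq_bigr => j js.
by have -> : (a == j) = false by apply: contraNF an => /eqP ->.
Qed.
End Inversions.

(** * Coordinates of the weight function *)

Section Words.
Variables (r l : nat) (par : 'I_r.+1 -> bool) (c : 'I_l -> 'I_r).

Definition oddF (u : 'I_l) : bool := parF par (c u).

(* The color words s for which the F's along s send e_1 to e_{a+1}. *)
Definition pattern (s : seq 'I_l) (a : nat) : bool :=
  [seq val (c u) | u <- s] == rev (iota 0 a).

Lemma pattern_nil a : pattern [::] a = (a == 0)%N.
Proof. by case: a => [|a] //; apply/eqP => /(congr1 size); rewrite size_rev. Qed.

Lemma pattern_cons u s a : pattern (u :: s) a = (a == (c u).+1) && pattern s (c u).
Proof.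
case: a => [|a]; first by [].
rewrite /pattern -addn1 iotaD rev_cat /= eqseq_cons add0n addn1 eqSS eq_sym.
by apply: andb_id2l => /eqP ->.
Qed.

Lemma size_pattern s a : pattern s a -> size s = a.
Proof. by move/eqP/(congr1 size); rewrite size_map size_rev size_iota. Qed.

Lemma map_pattern (f : 'I_l -> 'I_l) s a : (forall u, c (f u) = c u) ->
  pattern (map f s) a = pattern s a.
Proof. by move=> fc; rewrite /pattern -map_comp; under eq_map do rewrite /= fc. Qed.

(** The parity of each F is the sum of those of the two basis vectors it links, so the parities
    along a word telescope down to the even vector e_1. *)
Lemma odd_count_pattern s (a : 'I_r.+1) : par ord0 = false -> pattern s a ->
  odd (count oddF s) = par a.
Proof.
move=> par0; elim: s a => [|u s IHs] a.
  rewrite pattern_nil => /eqP a0; rewrite /= -par0; congr (par _).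
  exact/val_inj/esym.
rewrite pattern_cons => /andP[/eqP au su].
have -> : a = node_hi (c u) by apply: val_inj.
rewrite /= oddD (IHs (node_lo (c u))) //.
by rewrite oddb /oddF /parF /parE addbK.
Qed.

(** Each F sends a basis vector to the next one or to 0, without sign inside one tensor factor. *)
Lemma Fn_factorE (K : fieldType) s (a : 'I_r.+1) : Fn_factor K c s a 0 = (pattern s a)%:R.
Proof.
elim: s a => [|u s IHs] a; first by rewrite pattern_nil /Fn_factor /= /evec mxE andbT.
rewrite pattern_cons /= /Fmx /Emx mxE (bigD1 (node_lo (c u))) //= big1 => [|b bu].
  by rewrite addr0 IHs mxE eqxx andbT -natrM mulnb.
by rewrite mxE (negbTE bu) andbF mul0r.
Qed.

Section Chains.
Variables (K : fieldType) (t : 'I_l -> K).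

(** The word is read from the right, in the order in which the F's act: level 0 is [zk], and in a
    word satisfying [pattern] level [j.+1] carries the variable of color [j]. Past the end the value
    is 0 by default. *)
Definition chain_val (zk : K) (s : seq 'I_l) (j : nat) : K :=
  nth 0 (zk :: rev (map t s)) j.

Lemma chain_val_cons zk u s j : (j <= size s)%N ->
  chain_val zk (u :: s) j = chain_val zk s j.
Proof. by move=> js; rewrite /chain_val /= rev_cons -rcons_cons nth_rcons /= size_rev
  size_map ltnS js. Qed.

Lemma chain_val_last zk u s : chain_val zk (u :: s) (size s).+1 = t u.
Proof. by rewrite /chain_val /= rev_cons nth_rcons size_rev size_map ltnn eqxx. Qed.

Lemma chain_val_head zk s : chain_val zk s (size s) = head zk (map t s).
Proof. by case: s => [|u s] //; rewrite chain_val_last. Qed.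

Lemma chain_denE zk s :
  chain_den t zk s = \prod_(j < size s) (chain_val zk s j.+1 - chain_val zk s j).
Proof.
elim: s => [|u s IHs]; first by rewrite big_ord0.
rewrite /= big_ord_recr /= chain_val_last chain_val_cons // chain_val_head.
rewrite IHs mulrC; congr (_ * _); apply: eq_bigr => j _.
by rewrite !chain_val_cons // ltnW.
Qed.

Lemma pattern_nth u0 s a m : pattern s a -> (m < a)%N ->
  let u := nth u0 (rev s) m in [/\ u \in s, c u
    = m :> nat & forall zk, chain_val zk s m.+1 = t u].
Proof.
move=> sa ma; have ms : (m < size (rev s))%N by rewrite size_rev (size_pattern sa).
split; first by rewrite -mem_rev mem_nth.
  have := eqP sa; move/(congr1 (fun s => nth 0 (rev s) m)).
  by rewrite revK -map_rev (nth_map u0) // nth_iota.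
by move=> zk; rewrite /chain_val /= -map_rev (nth_map u0).
Qed.

Lemma nth_pattern_mem u0 s a u : pattern s a -> u \in s ->
  (c u < a)%N /\ nth u0 (rev s) (c u) = u.
Proof.
elim: s a => [|w s IHs] a //; rewrite pattern_cons in_cons => /andP[/eqP -> sw].
case/orP => [/eqP ->|us].
  by split=> //; rewrite rev_cons nth_rcons size_rev (size_pattern sw) ltnn eqxx.
have [lt e] := IHs _ sw us; split; first exact: ltnW.
by rewrite rev_cons nth_rcons size_rev (size_pattern sw) lt.
Qed.

(** A word of pattern [a] contains each color below [a] exactly once and no other color. *)
Lemma sum_color_pattern (f : K -> K) zk s a m : pattern s a ->
  \sum_(u <- s | c u == m :> nat) f (t u) = if (m < a)%N then f (chain_val zk s m.+1)
    else 0.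
Proof.
elim: s a => [|u s IHs] a; first by rewrite pattern_nil => /eqP ->; rewrite big_nil.
rewrite pattern_cons => /andP[/eqP -> su]; rewrite big_cons (IHs _ su) ltnS.
have sz := size_pattern su.
case: ltngtP => [lt|gt|->] //; first by rewrite chain_val_cons ?sz.
by rewrite addr0 -sz chain_val_last.
Qed.
End Chains.
End Words.

(** * Placements of the variables over the sites and their symmetries *)

Section Configurations.
Variables (r N l : nat) (par : 'I_r.+1 -> bool) (c : 'I_l -> 'I_r).

(** These are the ordered partitions whose vector [Fnv n] has a nonzero coordinate at [x]; that
    coordinate is then 1. *)
Definition config (x : {ffun 'I_N -> 'I_r.+1}) (n : parts N l) : bool :=
  (n \in ordered_partition N l) && [forall k, pattern c (n k) (x k)].

Definition config_sign (K : fieldType) (n : parts N l) :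
  K := (-1) ^+ inversions (oddF par c) (concat n).

Lemma configP (x : {ffun 'I_N -> 'I_r.+1}) n :
  reflect ((n \in ordered_partition N l) /\ forall k, pattern c (n k) (x k))
  (config x n).
Proof. by apply: (iffP andP) => -[-> /forallP]. Qed.

Lemma uniq_concat n : n \in ordered_partition N l -> uniq (concat n).
Proof. by rewrite inE => /perm_uniq ->; apply: enum_uniq. Qed.

Lemma mem_concat n u : n \in ordered_partition N l -> u \in concat n.
Proof. by rewrite inE => /perm_mem ->; rewrite mem_enum. Qed.

Lemma weight_funE (K : fieldType) (z : 'I_N -> K) (t : 'I_l -> K) x :
  weight_fun par c z t x = \sum_(n | config x n) config_sign K n * omega z t n.
Proof.
rewrite /weight_fun sum_ffunE big_mkcond [RHS]big_mkcond; apply: eq_bigr => n _.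
rewrite /config; case: ifP => //= nop; rewrite !ffunE.
have -> : \prod_k Fn_factor K c (n k) (x k) 0 = ([forall k, pattern c (n k) (x k)])%:R.
  rewrite (eq_bigr (fun k => (pattern c (n k) (x k))%:R)); last by move=> k _;
    rewrite Fn_factorE.
  case: (boolP [forall k, _]) => [/forallP h|]; first by rewrite big1 // => k _; rewrite h.
  by rewrite negb_forall => /existsP[k /negbTE h]; rewrite (bigD1 k) //= h mul0r.
have -> : #|odd_inversions par c n| = inversions (oddF par c) (concat n).
  by rewrite -card_inversions ?uniq_concat // => u; apply: mem_concat.
by case: forallP => _; rewrite -[_ *: _]/(_ * _) ?mulr1 ?mulr0.
Qed.

Lemma count_concat q (n : parts N l) : count q (concat n) = (\sum_k count q (n k))%N.
Proof. by rewrite /concat count_flatten -map_comp sumnE big_map big_enum. Qed.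

Lemma part_disjoint n i k u : n \in ordered_partition N l -> u \in n i -> u \in n k -> i
  = k.
Proof.
move=> nop ui uk; apply/eqP; apply: contraT => ik.
have := count_uniq_mem u (uniq_concat nop); rewrite mem_concat // count_concat.
rewrite (bigD1 i) //= (bigD1 k) 1?eq_sym //=.
by move: ui uk; rewrite -!has_pred1 !has_count /=; lia.
Qed.

(** Each chain longer than [m] holds one variable of color [m]. This translates sums over variables
    in the Bethe equations and the eigenvalue into sums over sites. *)
Lemma sum_color_config (K : fieldType) (z : 'I_N -> K) (t : 'I_l -> K) (f : K -> K) x n m :
  config x n ->
  \sum_(u | c u == m :> nat) f (t u)
  = \sum_(k | (m < x k)%N) f (chain_val t (z k) (n k) m.+1).
Proof.
case/configP => nop pat; have e : perm_eq (index_enum 'I_l) (concat n).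
  apply: uniq_perm; rewrite ?index_enum_uniq ?uniq_concat // => u.
  by rewrite mem_index_enum mem_concat.
rewrite (perm_big _ e) /= /concat big_flatten big_map big_enum [RHS]big_mkcond /=.
by apply: eq_bigr => k _; rewrite (sum_color_pattern t f (z k) m (pat k)).
Qed.

Definition relabel (a b : 'I_l) (n : parts N l) : parts N l :=
  [ffun k => [bseq of map (tperm a b) (n k)]].

Lemma relabelK a b : involutive (relabel a b).
Proof.
move=> n; apply/ffunP => k; apply: val_inj; rewrite !ffunE /= -map_comp.
by rewrite -[RHS]map_id; apply: eq_map => u /=; rewrite tpermK.
Qed.

Lemma concat_relabel a b n : concat (relabel a b n) = map (tperm a b) (concat n).
Proof.
rewrite /concat map_flatten -[in RHS](map_comp (map (tperm a b))); congr flatten.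
by apply: (@eq_map 'I_N) => k; rewrite /= ffunE.
Qed.

Lemma relabel_config x a b n : c a = c b -> config x n -> config x (relabel a b n).
Proof.
move=> cab /configP[nop pat]; apply/configP; split=> [|k]; last first.
  by rewrite ffunE map_pattern // => u; case: tpermP => // ->.
rewrite inE concat_relabel; apply: uniq_perm; rewrite ?enum_uniq //.
  by rewrite map_inj_uniq ?uniq_concat //; apply: perm_inj.
move=> u; rewrite mem_enum inE -[u](tpermK a b) mem_map ?mem_concat //; exact: perm_inj.
Qed.

Lemma config_sign_relabel (K : fieldType) a b n : n \in ordered_partition N l -> a != b ->
  c a = c b -> config_sign K (relabel a b n) = (-1) ^+ oddF par c a * config_sign K n.
Proof.
move=> nop ab cab; rewrite /config_sign concat_relabel -signr_odd odd_inversions_tperm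
  ?uniq_concat ?mem_concat //.
  by rewrite signr_addb signr_odd mulrC.
by rewrite /oddF cab.
Qed.

Definition swap_sites (i j : 'I_N) (T : Type) (f : {ffun 'I_N -> T}) : {ffun 'I_N -> T} :=
  [ffun k => f (tperm i j k)].

Lemma swap_sitesK i j T : involutive (@swap_sites i j T).
Proof. by move=> f; apply/ffunP => k; rewrite !ffunE tpermK. Qed.

Lemma swap_sitesC i j T : @swap_sites i j T =1 @swap_sites j i T.
Proof. by move=> f; apply/ffunP => k; rewrite !ffunE tpermC. Qed.

Lemma swap_config x i j n : config (swap_sites i j x) (swap_sites i j n) = config x n.
Proof.
wlog suff h : x n / config x n -> config (swap_sites i j x) (swap_sites i j n).
  by apply/idP/idP => /h //; rewrite !swap_sitesK.
move=> /configP[nop pat]; apply/configP; split=> [|k]; last by rewrite !ffunE.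
move: nop; rewrite !inE => nop; apply: perm_trans nop.
apply/seq.permP => q; rewrite !count_concat.
rewrite [RHS](reindex_inj (@perm_inj _ (tperm i j))) /=.
by apply: eq_bigr => k _; rewrite /= ffunE.
Qed.

End Configurations.

(** * The Hamiltonians as signed site exchanges *)

Section Between.
Variables (N : nat) (f : 'I_N -> nat).

Definition sum_between (i j : 'I_N) : nat := (\sum_(s : 'I_N | (i < s < j)%N) f s)%N.

Lemma sum_ltn_between (i j : 'I_N) : (i < j)%N ->
  (\sum_(s : 'I_N | (s < j)%N) f s = \sum_(s :
    'I_N | (s < i)%N) f s + f i + sum_between i j)%N.
Proof.
move=> ij; rewrite (bigID (fun s : 'I_N => s < i)%N) /= -addnA; congr (_ + _)%N.
  by apply: eq_bigl => s; case: (ltnP s i) => [lt|]; rewrite ?andbF // (ltn_trans lt).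
rewrite (bigD1 i) ?ij ?ltnn //=; congr (_ + _)%N; apply: eq_bigl => s.
by rewrite -val_eqE /=; case: (ltngtP s i) => //=; rewrite ?andbF ?andbT.
Qed.

(** Serves to display [concat n] as blocks, with the parts at [i] and [j] singled out. *)
Lemma enum_split (i j : 'I_N) : (i < j)%N ->
  exists E0 E1 E2, enum 'I_N = E0 ++ i :: E1 ++ j :: E2
    /\ (\sum_(s <- E1) f s = sum_between i j)%N.
Proof.
move=> ij.
have pw : pairwise (fun a b : 'I_N => a < b)%N (enum 'I_N).
  have : pairwise ltn (map val (enum 'I_N)).
    by rewrite val_enum_ord -sorted_pairwise ?iota_ltn_sorted //; apply: ltn_trans.
  by rewrite pairwise_map.
have := mem_enum 'I_N i; have := mem_enum 'I_N j.
have -> : sum_between i j = (\sum_(s <- enum 'I_N | (i < s < j)%N) f s)%N.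
  by rewrite big_enum_cond.
move: pw; set E := enum _ => pw jE iE; case/splitPr: iE pw jE => E0 E' pw.
rewrite mem_cat in_cons => /or3P[jE0|/eqP ji|jE'].
- move: pw; rewrite pairwise_cat => /and3P[/allrelP/(_ j i jE0)].
  by rewrite mem_head => /(_ isT) ji; move: (ltn_trans ij ji); rewrite ltnn.
- by rewrite ji ltnn in ij.
case/splitPr: jE' pw => E1 E2 pw; exists E0, E1, E2; split => //.
move: pw; rewrite !pairwise_cat /= pairwise_cat /=.
move=> /and3P[/allrelP h0 _ /andP[h1 /and4P[/allrelP h2 _ /allP h3 _]]].
rewrite big_cat big_cons big_cat big_cons /= !ltnn /= andbF.
rewrite [X in (X + _)%N]big1_seq ?add0n => [|s /andP[/andP[lt _] sE]]; last first.
  have := h0 _ i sE; rewrite mem_head => /(_ isT) lt'.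
  by move: (ltn_trans lt lt'); rewrite ltnn.
rewrite [X in (_ + X)%N]big1_seq ?addn0 => [|s /andP[/andP[_ lt] /h3 lt']]; last first.
  by move: (ltn_trans lt lt'); rewrite ltnn.
rewrite big_seq [RHS]big_seq_cond; apply: eq_bigl => s; case sE: (s \in E1) => //=.
rewrite (h2 s j) ?mem_head // andbT.
by move: h1; rewrite all_cat => /andP[/allP/(_ s sE) ->].
Qed.
End Between.

(** * Sign of a site exchange and coordinates of the Hamiltonians *)

Section Signs.
Variables (r N l : nat) (par : 'I_r.+1 -> bool) (c : 'I_l -> 'I_r).
Hypothesis par0 : par ord0 = false.

Lemma odd_sum (I : Type) (s : seq I) (P : pred I) (f g : I -> nat) :
  (forall i, P i -> odd (f i) = odd (g i)) ->
  odd (\sum_(i <- s | P i) f i)%N = odd (\sum_(i <- s | P i) g i)%N.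
Proof. by move=> fg; elim/big_rec2: _ => // i a b Pi e; rewrite !oddD e fg. Qed.

(** A block swap of the words at [i] and [j]; by [odd_count_pattern] the number of odd F's at a site
    has the parity of its basis vector. *)
Lemma odd_inversions_swap_sites (x : {ffun 'I_N -> 'I_r.+1}) n (i j : 'I_N) : (i < j)%N ->
  config c x n ->
  odd (inversions (oddF par c) (concat (swap_sites i j n))) =
  odd (inversions (oddF par c) (concat n)) (+) (par (x i) && par (x j))
   (+) ((par (x i) (+) par (x j)) && odd (sum_between (fun s => par (x s)) i j)).
Proof.
move=> ij /configP[nop pat].
have [E0 [E1 [E2 [eE e1]]]] := enum_split (fun s => par (x s)) ij.
have := uniq_concat nop; have := enum_uniq 'I_N.
rewrite /concat eE -e1 => uE.
have nij : forall s, s \in E0 ++ E1 ++ E2 -> swap_sites i j n s = n s.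
  move=> s; rewrite !mem_cat ffunE => sE; rewrite tpermD //.
    apply: contraTneq uE => es; move: sE; rewrite -es cat_uniq /= cat_uniq /= !mem_cat
      !in_cons negb_or.
    by case/or3P => -> ; rewrite /= ?orbT ?andbF.
  apply: contraTneq uE => es; move: sE; rewrite -es cat_uniq /= cat_uniq /= !mem_cat
    !in_cons negb_or.
  by rewrite !has_cat /= !negb_or; case/or3P => -> ; rewrite /= ?orbT ?andbF.
have fl E : {subset E <= E0 ++ E1 ++ E2} ->
    flatten [seq swap_sites i j n k : seq 'I_l | k <- E] = flatten [seq n k :
      seq 'I_l | k <- E].
  by move=> sub; congr flatten; apply/eq_in_map => s /sub/nij ->.
rewrite !map_cat !flatten_cat /= !map_cat !flatten_cat /= !fl; first last.
- by move=> s sE; rewrite !mem_cat sE.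
- by move=> s sE; rewrite !mem_cat sE orbT.
- by move=> s sE; rewrite !mem_cat sE !orbT.
rewrite !ffunE tpermL tpermR => /(odd_inversions_block_swap (oddF par c)) ->.
rewrite !(odd_count_pattern par0 (pat _)); congr (_ (+) (_ && _)).
rewrite count_flatten -map_comp sumnE big_map; apply: odd_sum => s _ /=.
by rewrite (odd_count_pattern par0 (pat s)) oddb.
Qed.

Definition set_site (x : {ffun 'I_N -> 'I_r.+1}) (k : 'I_N) (b : 'I_r.+1) :
  {ffun 'I_N -> 'I_r.+1} := [ffun s => if s == k then b else x s].

Section Gaudin.
Variable K : fieldType.

(** Only the basis vector that agrees with [x] off [k] and has [b] at [k] can contribute; the sign
    involves sites before [k] only, so it may be read off [x]. *)
Lemma EsiteE k a b (w : tensor K r N) x : Esite par k a b w x =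
  (x k == a)%:R * (-1) ^+ (\sum_(s < N | (s < k)%N) parE par a b * par (x s)) * w
    (set_site x k b).
Proof.
have ptE (y : {ffun 'I_N -> 'I_r.+1}) : ptensor (fun s =>
  if s == k then Emx K a b *m evec K (y s)
                        else evec K (y s)) x
   = (x k == a)%:R * (y == set_site x k b)%:R.
  rewrite ffunE (bigD1 k) //= eqxx.
  have -> : (Emx K a b *m evec K (y k)) (x k) 0 = (x k == a)%:R * (y k == b)%:R.
    by rewrite /Emx /evec mul_delta_mx_cond mulmxnE mxE eqxx andbT mulr_natr [b == _]eq_sym.
  rewrite -mulrA; congr (_ * _); case: (y =P set_site x k b) => [->|ne].
    rewrite ffunE !eqxx mul1r; apply: big1 => s sk.
    by rewrite (negbTE sk) mxE ffunE (negbTE sk) eqxx.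
  case: (y k =P b) => [yk|]; last by rewrite mul0r.
  rewrite mul1r; case: (pickP (fun s => (s != k) && (y s != x s))) => [s /andP[sk ys]|h].
    by rewrite (bigD1 s) //= (negbTE sk) mxE eq_sym (negbTE ys) mul0r.
  case: ne; apply/ffunP => s; rewrite ffunE; case: eqP => [->//|/eqP sk].
  by have /negbT := h s; rewrite sk /= negbK => /eqP.
rewrite /Esite sum_ffunE (bigD1 (set_site x k b)) //= [X in _ + X]big1 => [|y yne];
  last first.
  by rewrite 2!ffunE ptE (negbTE yne) mulr0 !scaler0.
rewrite addr0 2!ffunE ptE eqxx mulr1 -[LHS]/(_ * (_ * _)).
rewrite (eq_bigr (fun s => parE par a b * par (x s))%N).
  by rewrite [LHS]mulrC; congr (_ * _); rewrite [LHS]mulrC.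
by move=> s sk; rewrite ffunE -val_eqE /= (ltn_eqF sk).
Qed.

(* The sign with which the (i, j) term of H_i exchanges the sites i and j. *)
Definition exchange_sign (x : {ffun 'I_N -> 'I_r.+1}) (i j : 'I_N) : K :=
  (-1) ^+ par (x j) * (-1) ^+ (\sum_(s < N | (s < i)%N) parE par (x i) (x j) * par (x s))
  * (-1) ^+ (\sum_(s < N | (s < j)%N) parE par (x j) (x i) * par (set_site x i (x j) s)).

(** In the double sum over [a] and [b] only [a = x i], [b = x j] survives. *)
Lemma gaudinE z i (w : tensor K r N) x : gaudin par z i w x =
  \sum_(j | j != i) (z i - z j)^-1 * (exchange_sign x i j * w (swap_sites i j x)).
Proof.
rewrite /gaudin sum_ffunE; apply: eq_bigr => j ji; rewrite ffunE; congr (_ * _).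
rewrite sum_ffunE (bigD1 (x i)) //= [X in _ + X]big1 ?addr0 => [|a ai]; last first.
  by rewrite sum_ffunE big1 // => b _; rewrite ffunE EsiteE eq_sym (negbTE ai) !mul0r
    scaler0.
rewrite sum_ffunE (bigD1 (x j)) //= [X in _ + X]big1 ?addr0 => [|b bj]; last first.
  by rewrite ffunE !EsiteE ffunE (negbTE ji) [x j == b]eq_sym (negbTE bj) !(mul0r, mulr0)
    scaler0.
rewrite ffunE !EsiteE ffunE (negbTE ji) !eqxx !mul1r -[LHS]/(_ * _) /exchange_sign !mulrA.
congr (_ * w _); apply/ffunP => s; rewrite !ffunE.
case: tpermP => [->|->|/eqP/negbTE -> /eqP/negbTE ->] //; rewrite eqxx ?(negbTE ji) //.
by rewrite eq_sym (negbTE ji).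
Qed.

(** Both signs count the odd crossings of the entries at [i] and [j] with each other and with the
    sites in between; the sites before both cancel. *)
Lemma exchange_sign_config x i j n : i != j -> config c x n ->
  exchange_sign x i j * config_sign par c K (swap_sites i j n) = config_sign par c K n.
Proof.
move=> ij xn; pose px (s : 'I_N) := nat_of_bool (par (x s)).
pose L k := odd (\sum_(s < N | (s < k)%N) px s)%N.
pose M := odd (sum_between px i j + sum_between px j i)%N.
(* The operator at [j] sees site [i] already carrying [x j], which matters only when [i] precedes
   [j]. *)
have updL : odd (\sum_(s < N | (s < j)%N) par (set_site x i (x j) s))%N
    = if (i < j)%N then L j (+) par (x i) (+) par (x j) else L j.
  case: ifP => lt.
    rewrite (bigD1 i) //= ffunE eqxx /L [in RHS](bigD1 i) //= !oddD !oddb.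
    rewrite (eq_bigr px); last by move=> s /andP[_ si]; rewrite ffunE (negbTE si).
    by case: (par (x i)); case: (par (x j)); case: odd.
  apply: odd_sum => s sj; rewrite ffunE; case: eqP sj => // ->.
  by rewrite lt.
have btw0 (a b : 'I_N) : (a < b)%N -> sum_between px b a = 0%N.
  move=> ab; rewrite /sum_between big1 // => s /andP[bs sa].
  by have := ltn_trans ab (ltn_trans bs sa); rewrite ltnn.
have swapE : odd (inversions (oddF par c) (concat (swap_sites i j n))) =
    odd (inversions (oddF par c) (concat n)) (+) (par (x i) && par (x j))
    (+) ((par (x i) (+) par (x j)) && M).
  case: (ltngtP i j) => [lt|gt|/val_inj e]; last by rewrite e eqxx in ij.
    by rewrite /M (btw0 _ _ lt) addn0 (odd_inversions_swap_sites lt xn).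
  rewrite swap_sitesC /M (btw0 _ _ gt) add0n (odd_inversions_swap_sites gt xn).
  by rewrite [par (x j) && _]andbC [par (x j) (+) _]addbC.
have LM : L i (+) L j = (if (i < j)%N then par (x i) else par (x j)) (+) M.
  case: (ltngtP i j) => [lt|gt|/val_inj e]; last by rewrite e eqxx in ij.
    by rewrite /M /L (btw0 _ _ lt) (sum_ltn_between px lt) addn0 !oddD oddb -!addbA addKb.
  rewrite /M /L (btw0 _ _ gt) (sum_ltn_between px gt) add0n !oddD oddb.
  by rewrite addbC -!addbA addKb.
rewrite /config_sign /exchange_sign -(signr_odd _ (inversions _ _)) swapE -[RHS]signr_odd.
have signM (b : bool) m : (-1) ^+ (b * m) = (-1) ^+ (b && odd m) :> K.
  by rewrite -signr_odd oddM oddb.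
rewrite -!big_distrr /= !signM updL -/(L i) -!signr_addb; congr (_ ^+ nat_of_bool _).
rewrite /parE; move: LM.
by case: (i < j)%N; case: (par (x i)); case: (par (x j)); case: (L i); case: (L j); case:
  (M); case: odd.
Qed.
End Gaudin.
End Signs.

(** * Consequences of the Bethe equations *)

Section BetheEquations.
Variables (K : fieldType) (r N l : nat) (par : 'I_r.+1 -> bool) (c : 'I_l -> 'I_r).
Variables (z : 'I_N -> K) (t : 'I_l -> K).
Hypothesis par0 : par ord0 = false.
Hypothesis ht : bethe_equations par c z t.

(** The square length of an epsilon, indexed by natural numbers to allow level arithmetic; indices
    above [r] get a default from [inord]. *)
Definition node_sign (m : nat) : K := (-1) ^+ par (inord m).

Lemma node_sign_neq0 m : node_sign m != 0.
Proof. by rewrite /node_sign signr_eq0. Qed.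

Lemma node_sign0 : node_sign 0 = 1.
Proof. by rewrite /node_sign (_ : inord 0 = ord0) ?par0 //; apply: val_inj;
  rewrite /= inordK. Qed.

Lemma bform_alphal (p : 'I_r) (w : 'rV[K]_r.+1) : bform par (alpha K p) w =
  node_sign p * w 0 (node_lo p) - node_sign p.+1 * w 0 (node_hi p).
Proof.
have -> : node_sign p = (-1) ^+ par (node_lo p).
  by rewrite /node_sign; congr (_ ^+ nat_of_bool (par _)); apply: val_inj;
    rewrite /= inordK // leqW.
have -> : node_sign p.+1 = (-1) ^+ par (node_hi p).
  by rewrite /node_sign; congr (_ ^+ nat_of_bool (par _)); apply: val_inj;
    rewrite /= inordK // ltnS.
rewrite /bform /alpha /eps.
rewrite (eq_bigr (fun a => (-1) ^+ par a * (a == node_lo p)%:R * w 0 a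
   - (-1) ^+ par a * (a == node_hi p)%:R * w 0 a)); last first.
  by move=> a _; rewrite !mxE !eqxx /= mulrBr mulrBl.
rewrite sumrB; congr (_ - _).
  rewrite (bigD1 (node_lo p)) //= eqxx mulr1 big1 ?addr0 // => a /negbTE ->.
  by rewrite mulr0 mul0r.
rewrite (bigD1 (node_hi p)) //= eqxx mulr1 big1 ?addr0 // => a /negbTE ->.
by rewrite mulr0 mul0r.
Qed.

Lemma bform_alpha (p q : 'I_r) : bform par (alpha K p) (alpha K q) =
  (node_sign p + node_sign p.+1) * (q == p :> nat)%:R - node_sign p * (q.+1 == p)%:R
  - node_sign p.+1 * (q == p.+1 :> nat)%:R.
Proof.
rewrite bform_alphal /alpha /eps !mxE !eqxx /= -!val_eqE /= /bump !add1n !eqSS.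
rewrite ![p == _ :> nat]eq_sym [p.+1 == _ :> nat]eq_sym; ring.
Qed.

Lemma bform_alpha_eps0 (p : 'I_r) : bform par (alpha K p) (eps K ord0) = (p == 0 :> nat)%:R.
Proof.
rewrite bform_alphal /eps !mxE !eqxx /= -!val_eqE /= mulr0 subr0.
by case: eqP => [->|_]; rewrite ?mulr0 // node_sign0 mulr1.
Qed.

Lemma bethe_site u s : c u = 0 :> nat -> t u != z s.
Proof.
move=> cu; have [h _ _] := ht u; apply: h; rewrite bform_alpha_eps0 cu; exact: oner_neq0.
Qed.

Lemma bethe_next u w : c u = (c w).+1 :> nat -> t u != t w.
Proof.
move=> cu; have [_ h _] := ht u; apply: h.
  by apply: contraTneq isT => e; move: cu; rewrite e => /eqP; rewrite ltn_eqF.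
rewrite bform_alpha cu eqxx (ltn_eqF (ltnSn _)) (@ltn_eqF _ (c w).+2) ?leqnSn //.
by rewrite !mulr0 mulr1 sub0r subr0 oppr_eq0 node_sign_neq0.
Qed.

(** A simple root pairs nontrivially at most with itself and its two neighbors, so the Bethe
    equation groups by the colors just below, equal to and just above [c u]. *)
Lemma bethe_sum u :
  (c u == 0 :> nat)%:R * (\sum_s (t u - z s)^-1)
  + node_sign (c u) * (\sum_(w | (c w).+1 == c u) (t u - t w)^-1)
  = (node_sign (c u) + node_sign (c u).+1) * (\sum_(w | c w == c u :> nat) (t u - t w)^-1)
  - node_sign (c u).+1 * (\sum_(w | c w == (c u).+1 :> nat) (t u - t w)^-1).
Proof.
have ind (Q : pred 'I_l) (F : 'I_l -> K) : \sum_(w | Q w) F w = \sum_w (Q w)%:R * F w.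
  by rewrite big_mkcond; apply: eq_bigr => w _; case: (Q w); rewrite ?mul1r ?mul0r.
have [_ _] := ht u; rewrite [X in - X + _](_ : _
  = (c u == 0 :> nat)%:R * \sum_s (t u - z s)^-1).
  rewrite [X in _ + X](_ : _ = \sum_w bform par (alpha K (c u)) (alpha K (c w)) * (t u -
    t w)^-1).
    rewrite (ind (fun w => (c w).+1 == c u)) (ind (fun w => c w == c u :> nat)).
    rewrite (ind (fun w => c w == (c u).+1 :> nat)).
    set A := \sum_s (t u - z s)^-1; rewrite !mulr_sumr; move=> /eqP;
      rewrite addrC subr_eq0 => /eqP <-.
    rewrite -sumrB -big_split; apply: eq_bigr => w _ /=; rewrite bform_alpha.
    by ring.
  (* Restored terms vanish: either the coefficient is 0, or [w = u] and the inverse of 0 is 0. *)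
  rewrite big_mkcond; apply: eq_bigr => w _; case: ifP => // /negbT.
  rewrite negb_and !negbK => /orP[] /eqP ->; last by rewrite mul0r.
  by rewrite subrr invr0 mulr0.
rewrite mulr_sumr bform_alpha_eps0; case: (c u == 0 :> nat) => /=.
  by apply: eq_big => [s|s _]; rewrite ?oner_eq0.
by rewrite eqxx big_pred0_eq big1 // => s _; rewrite mul0r.
Qed.

(** The sign of the parity of F of color [m], by [color_signE]; it is the [chi] of the chain
    identity. *)
Definition color_sign (m : nat) : K := node_sign m * node_sign m.+1.

Section Config.
Variables (x : {ffun 'I_N -> 'I_r.+1}).

Definition site_val (n : parts N l) (k : 'I_N) (j : nat) : K := chain_val t (z k) (n k) j.

Lemma config_cell n k m : config c x n -> (m < x k)%N ->
  exists u, [/\ u \in n k, c u = m :> nat & site_val n k m.+1 = t u].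
Proof.
case/configP => nop /(_ k) pat mk.
case en : (n k : seq 'I_l) (size_pattern pat) => [|u0 s] sz; first by rewrite -sz in mk.
have [un cu tu] := pattern_nth t u0 pat mk.
by exists (nth u0 (rev (n k)) m); split=> //; apply: tu.
Qed.

Lemma bethe_neq_next n i k m : config c x n -> (m < x i)%N -> (m <= x k)%N ->
  site_val n i m.+1 - site_val n k m != 0.
Proof.
move=> xn mi mk; rewrite subr_eq0; have [u [_ cu ->]] := config_cell xn mi.
case: m mi mk cu => [|m] mi mk cu; first exact: bethe_site.
have [w [_ cw ->]] := config_cell xn mk.
by apply: bethe_next; rewrite cu cw.
Qed.

(* The term [k = i] may be added or dropped freely on the right: it is [0^-1 = 0]. *)
Lemma bethe_config n i m : config c x n -> (m < x i)%N ->
  \sum_(k : 'I_N | (m <= x k)%N) (site_val n i m.+1 - site_val n k m)^-1 =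
  (1 + color_sign m) * (\sum_(k : 'I_N | (k != i) && (m < x k)%N)
                    (site_val n i m.+1 - site_val n k m.+1)^-1)
  - color_sign m * (\sum_(k : 'I_N | (m.+1 < x k)%N) (site_val n i m.+1 - site_val n k
    m.+2)^-1).
Proof.
move=> xn mi; have [u [_ cu tu]] := config_cell xn mi.
have := bethe_sum u; rewrite cu.
rewrite !(sum_color_config z t (fun y => (t u - y)^-1) _ xn).
set S1 := \sum_(k | (m < x k)%N) _; set S2 := \sum_(k | (m.+1 < x k)%N) _ => e.
rewrite tu (_ : \sum_(k | (k != i) && _) _ = S1); last first.
  rewrite /S1 (bigD1 i mi) /= -/(site_val _ _ _) tu subrr invr0 add0r.
  by apply: eq_bigl => k; rewrite andbC.
have sg2 j : node_sign j * node_sign j = 1 by rewrite -expr2 sqrr_sign.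
have {e} : node_sign m * \sum_(k : 'I_N | (m <= x k)%N) (t u - site_val n k m)^-1
    = (node_sign m + node_sign m.+1) * S1 - node_sign m.+1 * S2.
  rewrite -e; case: m {mi tu S1 S2 e cu} => [|m].
    by rewrite node_sign0 eqxx !mul1r [X in _ + X]big1 // addr0; apply: eq_big.
  by rewrite mul0r add0r (sum_color_config z t (fun y => (t u - y)^-1) _ xn).
move/(congr1 ( *%R (node_sign m))); rewrite mulrA sg2 mul1r => ->.
by rewrite /color_sign mulrBr !mulrA mulrDr sg2.
Qed.

Lemma site_val_mem n k u : config c x n -> u \in n k ->
  (c u < x k)%N /\ site_val n k (c u).+1 = t u.
Proof.
case/configP => _ /(_ k) pat un; have [lt e] := nth_pattern_mem u pat un.
by have [_ _ tu] := pattern_nth t u pat lt; split=> //; rewrite /site_val tu e.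
Qed.

Lemma site_val_relabel n i k m a b : config c x n -> a \in n i -> b \in n k ->
    c a = m :> nat -> c b = m :> nat -> forall p j,
  site_val (relabel a b n) p j = swap_level i k m.+1 (site_val n) p j.
Proof.
move=> xn ai bk ca cb p [|j]; first by [].
have [mi ta] := site_val_mem xn ai; have [mk tb] := site_val_mem xn bk.
rewrite ca cb in mi ta mk tb; case/configP: (xn) => nop pat.
(* Renaming the entries of the words amounts to permuting the values [t]. *)
have -> : site_val (relabel a b n) p j.+1 = chain_val (t \o tperm a b) (z p) (n p) j.+1.
  by rewrite /site_val ffunE /chain_val /= -map_comp.
rewrite /swap_level eqSS; case: (ltnP j (x p)) => [lt|ge].
  have [up cu /(_ (z p)) tu] := pattern_nth t a (pat p) lt.
  have [_ _ ->] := pattern_nth (t \o tperm a b) a (pat p) lt.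
  move: up cu tu; set u := nth _ _ _ => /= up cu tu; case: tpermP =>
    [ua|ub|/eqP ua /eqP ub].
  - have pi : p = i by apply: part_disjoint nop up _; rewrite ua.
    by rewrite -cu ua ca eqxx pi tpermL tb.
  - have pk : p = k by apply: part_disjoint nop up _; rewrite ub.
    by rewrite -cu ub cb eqxx pk tpermR ta.
  case: eqP => [jm|_]; last by rewrite /site_val tu.
  have inj q v : v \in n q -> c v = m :> nat -> p = q -> u = v.
    move=> vq cv pq; have [_ <-] := nth_pattern_mem a (pat q) vq.
    by rewrite /u pq cv jm.
  rewrite tpermD; first by rewrite /site_val tu.
    by apply: contraNneq ua => e; rewrite (inj i a) // e.
  by apply: contraNneq ub => e; rewrite (inj k b) // e.
(* Past the end of the chain both sides are the default 0; if [j = m], then [p] is neither [i] nor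
   [k], whose chains are longer. *)
rewrite (_ : (if _ then _ else _) = site_val n p j.+1).
  by rewrite /site_val /chain_val /= !nth_default // size_rev size_map (size_pattern (pat
    p)).
case: eqP => // jm; rewrite tpermD //.
  by apply: contraTneq ge => <-; rewrite -ltnNge jm.
by apply: contraTneq ge => <-; rewrite -ltnNge jm.
Qed.

Lemma bethe_neq_same n i k m : (forall u w, u != w -> c u = c w -> t u != t w) ->
  injective z -> config c x n -> i != k -> (m <= x i)%N -> (m <= x k)%N ->
  site_val n i m - site_val n k m != 0.
Proof.
move=> tinj zinj xn ik; rewrite subr_eq0; case: m => [_ _|m mi mk].
  by apply: contraNneq ik => /zinj ->.
have [u [ui cu ->]] := config_cell xn mi; have [w [wk cw ->]] := config_cell xn mk.
apply: tinj; last by apply: val_inj; rewrite /= cu cw.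
apply: contraNneq ik => e; rewrite e in ui; apply/eqP.
by case/configP: xn => nop _; apply: part_disjoint nop ui wk.
Qed.

Lemma color_signE u : (-1) ^+ oddF par c u = color_sign (c u).
Proof.
rewrite /color_sign /node_sign /oddF /parF /parE signr_addb mulrC.
congr ((-1) ^+ nat_of_bool (par _) * (-1) ^+ nat_of_bool (par _)); apply: val_inj.
  by rewrite /= inordK // leqW.
by rewrite /= inordK // ltnS.
Qed.

(** The exchanged pair depends on [n]: it is the pair of variables of color [m] found at [i] and
    [k]. The exchanged placement has the same pair at these sites, so the map is an involution. *)
Lemma relabel_swapP i k m : i != k -> (m < x i)%N -> (m < x k)%N ->
  exists2 psi : parts N l -> parts N l,
    forall n, config c x n -> config c x (psi n) /\ psi (psi n) = n
    & forall n, config c x n -> config_sign par c K (psi n)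
      = color_sign m * config_sign par c K n
               /\ forall p j, site_val (psi n) p j = swap_level i k m.+1 (site_val n) p j.
Proof.
move=> ik mi mk; case: (pickP 'I_l) => [u0 _|no]; last first.
  by exists id => n xn; have [u] := config_cell xn mi; have := no u.
pose cell (n : parts N l) j := nth u0 (rev (n j)) m.
have cellP n j : config c x n -> (m < x j)%N -> cell n j \in n j /\ c (cell n j) = m :> nat.
  by case/configP => _ /(_ j) pat mj; have [] := pattern_nth t u0 pat mj.
have celleq n : config c x n -> c (cell n i) = c (cell n k).
  by move=> xn; apply: val_inj; rewrite /= (cellP _ _ xn mi).2 (cellP _ _ xn mk).2.
have cellne n : config c x n -> cell n i != cell n k.
  move=> xn; have [ai _] := cellP _ _ xn mi; have [bk _] := cellP _ _ xn mk.
  case/configP: xn => nop _; apply: contraNneq ik => e; rewrite e in ai.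
  by apply/eqP; apply: part_disjoint nop ai bk.
exists (fun n => relabel (cell n i) (cell n k) n) => n xn.
  split; first exact: relabel_config (celleq n xn) xn.
  have cellr j : cell (relabel (cell n i) (cell n k) n) j
      = tperm (cell n i) (cell n k) (cell n j) \/ (x j <= m)%N.
    case: (ltnP m (x j)) => [mj|]; [left|by right].
    case/configP: xn => _ /(_ j) pat; rewrite /cell ffunE /= -map_rev (nth_map u0) //.
    by rewrite size_rev (size_pattern pat).
  case: (cellr i); last by rewrite leqNgt mi.
  case: (cellr k); last by rewrite leqNgt mk.
  by move=> -> ->; rewrite tpermL tpermR -[RHS](relabelK (cell n i) (cell n k)) /relabel
    tpermC.
have [ai ca] := cellP _ _ xn mi; have [bk cb] := cellP _ _ xn mk; split.
  case/configP: (xn) => nop _.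
  by rewrite (config_sign_relabel _ _ nop (cellne _ xn) (celleq _ xn)) color_signE ca.
exact: site_val_relabel xn ai bk ca cb.
Qed.
End Config.
End BetheEquations.

(** With 0-based indices [x k] is the number of F's needed to reach its basis vector from e_1, hence
    the length of the chain at [k]. *)
Definition height (r N : nat) (x : {ffun 'I_N -> 'I_r.+1}) (k : 'I_N) : nat := x k.

(** * The eigenvalue equation in coordinates *)

Section Eigenvector.
Variables (K : fieldType) (r N l : nat) (par : 'I_r.+1 -> bool) (c : 'I_l -> 'I_r).
Variables (z : 'I_N -> K) (t : 'I_l -> K).

Lemma omega_chains (x : {ffun 'I_N -> 'I_r.+1}) n : config c x n -> omega z t n
  = chains (height x) (site_val z t n).
Proof.
case/configP => _ pat; rewrite /omega /chains; apply: eq_bigr => k _.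
by rewrite chain_denE prodfV (size_pattern (pat k)).
Qed.

(** Exchanging two words is, after renaming the sites, the same as exchanging their base points z_i
    and z_j. *)
Lemma omega_swap_sites (x : {ffun 'I_N -> 'I_r.+1}) n i j : config c x n ->
  omega z t (swap_sites i j n) = chains (height x) (swap_level i j 0 (site_val z t n)).
Proof.
case/configP => _ pat; rewrite /omega /chains (reindex_inj (@perm_inj _ (tperm i j))) /=.
apply: eq_bigr => k _; rewrite ffunE tpermK chain_denE -prodfV (size_pattern (pat k)).
by apply: eq_bigr => m _; rewrite /swap_level /=; case: (nat_of_ord m).
Qed.

Hypothesis par0 : par ord0 = false.
Hypothesis ht : bethe_equations par c z t.
Hypothesis zinj : injective z.

(* Two equal variables of the same color can only be odd, and the weight function is
   antisymmetric in the odd variables of a given color. *)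
Lemma weight_fun_eq0 a b : (2 : K) != 0 -> a != b -> c a = c b -> t a = t b ->
  weight_fun par c z t = 0.
Proof.
move=> two ab cab tab; apply/ffunP => x; rewrite weight_funE ffunE.
(* For an even color the root has square length 2 or -2, so the Bethe equations force
   [t a != t b]. *)
have odda : oddF par c a.
  have [_ h _] := ht a; apply: contraT => pa.
  have /negP[] : t a != t b; last by apply/eqP.
  apply: h; first by rewrite eq_sym.
  have := color_signE K par c a; rewrite (negbTE pa) /color_sign expr0 => e.
  have sgE : node_sign K par (c a).+1 = node_sign K par (c a).
    by rewrite -[RHS]mulr1 [X in _ * X]e mulrA -expr2 sqrr_sign mul1r.
  rewrite bform_alpha sgE -cab eqxx (gtn_eqF (ltnSn _)) (ltn_eqF (ltnSn _)) !mulr0 !subr0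
    mulr1 -mulr2n.
  by rewrite -mulr_natr mulf_neq0 // node_sign_neq0.
(* Exchanging [a] and [b] permutes the placements, keeps [omega] because [t a = t b], and reverses
   the sign. *)
set S := \sum_(n | _) _; have : S = - S.
  rewrite {1}/S (reindex_inj (can_inj (relabelK a b))) /= -sumrN.
  apply: eq_big => n.
    apply/idP/idP => [|xn]; last exact: relabel_config.
    by move/(relabel_config cab); rewrite relabelK.
  move/(relabel_config cab); rewrite relabelK => xn.
  rewrite config_sign_relabel //; last by case/configP: xn.
  rewrite odda mulN1r mulNr; congr (- (_ * _)).
  rewrite /omega; apply: eq_bigr => k _; rewrite ffunE !chain_denE /= size_map.
  congr (_^-1); apply: eq_bigr => j _; rewrite /chain_val -map_comp.
  have -> : map (t \o tperm a b) (n k) = map t (n k); last by [].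
  by apply: eq_map => u /=; case: tpermP => // ->.
by move/eqP; rewrite -subr_eq0 opprK -mulr2n -mulr_natr mulf_eq0 (negbTE two) orbF => /eqP.
Qed.

Lemma gaudin_weight_fun_inj : (forall u w, u != w -> c u = c w -> t u != t w) -> forall i,
  gaudin par z i (weight_fun par c z t) = gaudin_eigenvalue c z t i *: weight_fun par c z t.
Proof.
move=> tinj i; apply/ffunP => x; rewrite gaudinE ffunE weight_funE -[RHS]/(_ * _).
have dz : defect (config c x) (height x) (site_val z t) (config_sign par c K) i 0 = 0.
  apply: (@defect_eq0 _ _ _ _ _ _ _ (color_sign K par)) => //.
  - move=> i' k m ik mi mk; exact: (relabel_swapP par c z t ik mi mk).
  - move=> n i' k m; exact: (bethe_neq_next par0 ht).
  - move=> n i' k m; exact: (bethe_neq_same).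
  - move=> n i' m; exact: (bethe_config par0 ht).
apply: subr0_eq; rewrite -[RHS]dz /defect mulr_sumr.
(* Reindexing by the site exchange absorbs the super sign and leaves the ratio caused by exchanging
   z_i and z_j. *)
have -> : \sum_(j | j != i) (z i - z j)^-1 * (exchange_sign par K x i j * weight_fun par
  c z t (swap_sites i j x))
   = \sum_(j | j != i) \sum_(n | config c x n)
      config_sign par c K n * chains (height x) (site_val z t n) * (swap_ratio (height x)
        i j 0 (site_val z t n) / (z i - z j)).
  apply: eq_bigr => j ji; rewrite weight_funE (reindex_inj (can_inj (@swap_sitesK _ i j
    _))) /=.
  rewrite !mulr_sumr; apply: eq_big => [n|n]; first by rewrite swap_config.
  rewrite swap_config => xn; rewrite [exchange_sign _ _ _ _ _ * _]mulrA
    exchange_sign_config // 1?eq_sym //.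
  rewrite (omega_swap_sites _ _ xn) chains_swap0 1?eq_sym //; last first.
    by move=> p q m; apply: (bethe_neq_next par0 ht).
  by rewrite mulrC !mulrA.
rewrite exchange_big /= -sumrB; apply: eq_bigr => n xn.
rewrite -mulr_sumr (omega_chains xn) [X in _ - X]mulrC -mulrBr; congr (_ * _).
(* The first sum of the eigenvalue supplies the -1 next to each [swap_ratio], the second one the
   links from level 0 to level 1. *)
rewrite /gaudin_eigenvalue opprD addrA.
rewrite (sum_color_config z t (fun y => (y - z i)^-1) _ xn); congr (_ - _).
rewrite -sumrB; apply: eq_big => [k|k ki]; first by rewrite andbT.
by rewrite mulrBl mul1r.
Qed.

End Eigenvector.

(** * Values of rational functions *)

Section RatValue.
Variables (K : fieldType) (d : nat) (pt : 'I_d -> K).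
Implicit Types (f g : ratfun K d).

Lemma rat_value_poly (p : {mpoly K[d]}) : rat_value (tofrac p) pt p.@[pt].
Proof. by exists p, 1; rewrite meval1 rmorph1 !divr1; split=> //; apply: oner_neq0. Qed.

Lemma rat_value0 : rat_value (0 : ratfun K d) pt 0.
Proof. by have := rat_value_poly 0; rewrite rmorph0 meval0. Qed.

Lemma rat_value1 : rat_value (1 : ratfun K d) pt 1.
Proof. by have := rat_value_poly 1; rewrite rmorph1 meval1. Qed.

Lemma tofrac_neq0 (q : {mpoly K[d]}) : q.@[pt] != 0 -> tofrac q != 0.
Proof. by rewrite tofrac_eq0; apply: contraNneq => ->; rewrite meval0. Qed.

Lemma rat_valueN f v : rat_value f pt v -> rat_value (- f) pt (- v).
Proof.
case=> p [q [q0 -> ->]]; exists (- p), q.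
by rewrite rmorphN mevalN !mulNr.
Qed.

Lemma rat_valueD f g v w : rat_value f pt v -> rat_value g pt w ->
  rat_value (f + g) pt (v + w).
Proof.
case=> p [q [q0 -> ->]] [p' [q' [q0' -> ->]]]; exists (p * q' + p' * q), (q * q').
by rewrite mevalM mulf_neq0 // rmorphD !rmorphM mevalD !mevalM !addf_div // tofrac_neq0.
Qed.

Lemma rat_valueM f g v w : rat_value f pt v -> rat_value g pt w ->
  rat_value (f * g) pt (v * w).
Proof.
case=> p [q [q0 -> ->]] [p' [q' [q0' -> ->]]]; exists (p * p'), (q * q').
by rewrite !mevalM mulf_neq0 // !rmorphM !mulf_div.
Qed.

Lemma rat_valueV f v : v != 0 -> rat_value f pt v -> rat_value f^-1 pt v^-1.
Proof.
move=> v0 [p [q [q0 -> e]]]; exists q, p; rewrite e !invf_div; split=> //.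
by move: v0; rewrite e mulf_eq0 negb_or => /andP[].
Qed.

Lemma rat_value_sum (I : Type) (s : seq I) (P : pred I) (f : I -> ratfun K d) (v : I -> K) :
  (forall i, P i -> rat_value (f i) pt (v i)) ->
  rat_value (\sum_(i <- s | P i) f i) pt (\sum_(i <- s | P i) v i).
Proof.
by move=> fv; elim/big_rec2: _ => [|i w g Pi]; [apply: rat_value0|apply/rat_valueD/fv].
Qed.

Lemma rat_value_prod (I : Type) (s : seq I) (P : pred I) (f : I -> ratfun K d) (v :
  I -> K) :
  (forall i, P i -> rat_value (f i) pt (v i)) ->
  rat_value (\prod_(i <- s | P i) f i) pt (\prod_(i <- s | P i) v i).
Proof.
by move=> fv; elim/big_rec2: _ => [|i w g Pi]; [apply: rat_value1|apply/rat_valueM/fv].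
Qed.

Lemma rat_value_sign n : rat_value ((-1) ^+ n : ratfun K d) pt ((-1) ^+ n).
Proof.
by elim: n => [|n IHn]; rewrite ?exprS; [apply:
  rat_value1|apply/rat_valueM/IHn/rat_valueN/rat_value1].
Qed.

Lemma rat_value_chain_val l (T : 'I_l -> ratfun K d) (t : 'I_l -> K) Z zk s j :
  (forall u, rat_value (T u) pt (t u)) -> rat_value Z pt zk ->
  rat_value (chain_val T Z s j) pt (chain_val t zk s j).
Proof.
move=> Tt Zz; rewrite /chain_val; case: j => //= j; rewrite -!map_rev.
elim: (rev s) j => [|u s' IHs] [|j] //=; exact: rat_value0.
Qed.

End RatValue.

(* Only differences t_i - t_j with c(i) = c(j) + 1 and t_i - z_k with c(i) = 1 occur in
   terms with [Fnv n != 0], and the Bethe equations make them nonzero: there are no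
   apparent poles. *)
Lemma weight_value_weight_fun (K : fieldType) (r N l : nat) (par : 'I_r.+1 -> bool)
    (c : 'I_l -> 'I_r) (z : 'I_N -> K) (t : 'I_l -> K) :
  par ord0 = false -> bethe_equations par c z t ->
  weight_value par c z t (weight_fun par c z t).
Proof.
move=> par0 ht x; rewrite /weight_rat !weight_funE; apply: rat_value_sum => n xn.
apply: rat_valueM; first exact: rat_value_sign.
rewrite !(omega_chains _ _ xn); apply: rat_value_prod => k _; apply: rat_value_prod => j _.
apply: rat_valueV; first by apply: (bethe_neq_next par0 ht xn) => //; apply: ltnW.
have valX i : rat_value (tofrac 'X_i) (joint_point z t) (joint_point z t i).
  by have := rat_value_poly (joint_point z t) 'X_i; rewrite mevalXU.
have valz (s : 'I_N) : rat_value (tofrac 'X_(lshift l s)) (joint_point z t) (z s).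
  by have := valX (lshift l s); rewrite {2}/joint_point (unsplitK (inl _ s)).
have valt (u : 'I_l) : rat_value (tofrac 'X_(rshift N u)) (joint_point z t) (t u).
  by have := valX (rshift N u); rewrite {2}/joint_point (unsplitK (inr _ u)).
by apply: rat_valueD; [|apply: rat_valueN]; apply: rat_value_chain_val.
Qed.

Theorem theorem4p4 (R : realType) (m n r N l : nat)
    (hr : (m + n)%N = r.+1)
    (par : 'I_r.+1 -> bool)
    (hm : #|[pred a | ~~ par a]| = m) (hn : #|[pred a | par a]| = n)
    (par1 : par ord0 = false)
    (hN : (1 < N)%N)
    (z : 'I_N -> R[i]) (hz : injective z)
    (ls : 'I_r -> nat) (hl : (\sum_(p < r) ls p)%N = l)
    (c : 'I_l -> 'I_r) (hc : forall p : 'I_r, #|[pred i | c i == p]| = ls p)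
    (t : 'I_l -> R[i]) (ht : bethe_equations par c z t) :
  exists W : tensor R[i] r N,
    weight_value par c z t W /\
    forall i : 'I_N, gaudin par z i W = gaudin_eigenvalue c z t i *: W.
Proof.
exists (weight_fun par c z t); split; first exact: weight_value_weight_fun.
(* Coinciding variables of equal color make the vector 0 and the equation trivial; otherwise the
   chain identity applies. *)
case: (boolP [exists u, exists w, [&& u != w, c u == c w & t u == t w]]).
  case/existsP => a /existsP[b /and3P[ab /eqP cab /eqP tab]] i.
  rewrite (weight_fun_eq0 ht _ ab cab tab) ?Num.Theory.pnatr_eq0 // scaler0.
  apply/ffunP => x; rewrite gaudinE ffunE big1 // => j _.
  by rewrite ffunE !mulr0.
move=> tinj; apply: gaudin_weight_fun_inj => // u w uw cuw.
apply: contraNneq tinj => tuw; apply/existsP; exists u; apply/existsP; exists w.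
by rewrite uw cuw tuw !eqxx.
Qed.
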